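(* If $\hat{\mathsf C}=\hat{\mathsf R}(\mathrm i)$, where $\hat{\mathsf R}$ is an ordered field, then $\hat{\mathsf C}$ is formally Morita equivalent to $\mathfrak F(\mathfrak H)$, the $^*$-algebra of finite rank operators on $\mathfrak H$, where $\mathfrak H$ is any pre-Hilbert space over $\hat{\mathsf C}$.
   Context: $\hat{\mathsf C}=\hat{\mathsf R}\oplus\mathrm i\hat{\mathsf R}$ with $\mathrm i^2=-1$ and the usual conjugation (making $\hat{\mathsf C}$ a $^*$-algebra over itself). A pre-Hilbert space over $\hat{\mathsf C}$ is a $\hat{\mathsf C}$-vector space with a $\hat{\mathsf C}$-valued inner product, linear in the second argument, Hermitian, with $\langle\phi,\phi\rangle\ge0$ and $\langle\phi,\phi\rangle=0\Rightarrow\phi=0$ (no completeness). $\mathfrak F(\mathfrak H)$ is the $\hat{\mathsf C}$-span of the operators $\Theta_{x,y}(z)=x\langle y,z\rangle$, $x,y\in\mathfrak H$, with involution $\Theta_{x,y}^*=\Theta_{y,x}$. Write $\mathsf C=\hat{\mathsf C}$. A $^*$-algebra over $\mathsf C$ is an associative (not necessarily unital) $\mathsf C$-algebra with an antilinear involution satisfying $(AB)^*=B^*A^*$. A linear $\omega:\mathcal A\to\mathsf C$ is positive if $\omega(A^*A)\ge0$ for all $A$; a Hermitian $A$ is positive ($A\ge0$) if $\omega(A)\ge0$ for all positive linear functionals $\omega$. A $^*$-representation is a $^*$-homomorphism into the adjointable endomorphisms of a pre-Hilbert space. A $(\mathcal B$-$\mathcal A)$-equivalence bimodule is a $\mathsf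 C$-module $\mathfrak X$ with commuting left $\mathcal B$- and right $\mathcal A$-actions and maps $\langle\cdot,\cdot\rangle_{\mathcal A}:\mathfrak X\times\mathfrak X\to\mathcal A$, ${}_{\mathcal B}\langle\cdot,\cdot\rangle:\mathfrak X\times\mathfrak X\to\mathcal B$ such that: E1) X1) $\langle\cdot,\cdot\rangle_{\mathcal A}$ is $\mathsf C$-linear in the second argument; X2) $\langle x,y\rangle_{\mathcal A}=\langle y,x\rangle_{\mathcal A}^*$; X3) $\langle x,y\cdot A\rangle_{\mathcal A}=\langle x,y\rangle_{\mathcal A}A$; X4) $\langle x,x\rangle_{\mathcal A}\ge0$; X5) $\langle x,B\cdot y\rangle_{\mathcal A}=\langle B^*\cdot x,y\rangle_{\mathcal A}$; X6) the $\mathsf C$-span of all $\langle x,y\rangle_{\mathcal A}$ is $\mathcal A$. E2) Y1) ${}_{\mathcal B}\langle\cdot,\cdot\rangle$ is $\mathsf C$-linear in the first argument; Y2) ${}_{\mathcal B}\langle x,y\rangle={}_{\mathcal B}\langle y,x\rangle^*$; Y3) ${}_{\mathcal B}\langle B\cdot x,y\rangle=B\,{}_{\mathcal B}\langle x,y\rangle$; Y4) ${}_{\mathcal B}\langle x,x\rangle\ge0$; Y5) ${}_{\mathcal B}\langle x\cdot A,y\rangle={}_{\mathcal B}\langle x,y\cdot A^*\rangle$; Y6) the $\mathsf C$-span of all ${}_{\mathcal B}\langle x,y\rangle$ is $\mathcal B$. E3) ${}_{\mathcal B}\langle x,y\rangle\cdot z=x\cdot\langle y,z\rangle_{\mathcal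 A}$. E4) P): for every $^*$-representation $(\mathfrak K,\pi)$ of $\mathcal A$ the form determined by $\langle x\otimes\psi,y\otimes\phi\rangle=\langle\psi,\pi(\langle x,y\rangle_{\mathcal A})\phi\rangle$ on the $\mathcal A$-balanced tensor product $\mathfrak X\otimes_{\mathcal A}\mathfrak K$ is positive semi-definite; and Q): P holds for the conjugate $(\mathcal A$-$\mathcal B)$-bimodule $\overline{\mathfrak X}$ (conjugate $\mathsf C$-module, $A\bar x=\overline{xA^*}$, $\bar xB=\overline{B^*x}$) with $\langle\bar x,\bar y\rangle_{\mathcal B}={}_{\mathcal B}\langle x,y\rangle$. $\mathcal A$ and $\mathcal B$ are formally Morita equivalent if a $(\mathcal B$-$\mathcal A)$-equivalence bimodule exists (a symmetric relation).
   Formalization: The pre-Hilbert space is assumed nonzero: for the zero space the algebra of finite rank operators is zero, and E3, X3 and X6 then contradict each other, so the claim fails in that case. *)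

(* Defs.v *)
From HB Require Import structures.
From mathcomp Require Import all_boot all_order all_algebra.
From mathcomp Require Import boolp classical_sets functions.
From mathcomp.real_closed Require Import complex.
From mathcomp.multinomials Require Import monalg.

Set Implicit Arguments.
Unset Strict Implicit.
Unset Printing Implicit Defensive.

Import GRing.Theory Num.Theory.
Local Open Scope ring_scope.
Local Notation "z ^*" := (conjc z) : ring_scope.
Local Open Scope quotient_scope.

(* MathComp orders [R[i]] and makes conjugation a ring morphism only over a
   real closed field, whereas [R] is here an arbitrary ordered field. *)
Section Scalars.
Variable R : realFieldType.
Implicit Types z w : R[i].

Definition nonneg z : bool := (complex.Im z == 0) && (0 <= complex.Re z).

Lemma conjcD z w : (z + w)^* = z^* + w^*.
Proof. by case: z w => [a b] [c d]; congr Complex; exact: opprD. Qed.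

Lemma conjcM z w : (z * w)^* = z^* * w^*.
Proof.
case: z w => [a b] [c d]; congr Complex.
  by rewrite mulrN mulNr opprK.
by rewrite opprD mulrN mulNr.
Qed.

Lemma conjcK z : z^*^* = z.
Proof. by case: z => a b; congr Complex; exact: opprK. Qed.

Lemma conjc0 : (0 : R[i])^* = 0.
Proof. by congr Complex; exact: oppr0. Qed.

End Scalars.

HB.mixin Record Lmodule_isStarAlgebra (R : realFieldType) A
    of GRing.Lmodule R[i] A := {
  smul : A -> A -> A;
  star : A -> A;
  smulA : associative smul;
  smulDl : left_distributive smul +%R;
  smulDr : right_distributive smul +%R;
  smulZl : forall (c : R[i]) a b, smul (c *: a) b = c *: smul a b;
  smulZr : forall (c : R[i]) a b, smul a (c *: b) = c *: smul a b;
  starD : {morph star : a b / a + b >-> a + b};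
  starZ : forall (c : R[i]) a, star (c *: a) = c^* *: star a;
  starK : involutive star;
  starM : forall a b, star (smul a b) = smul (star b) (star a)
}.

#[short(type="starAlgType")]
HB.structure Definition StarAlgebra (R : realFieldType) :=
  {A of Lmodule_isStarAlgebra R A & GRing.Lmodule R[i] A}.

Notation "a ** b" := (smul a b) (at level 40, left associativity) : ring_scope.

HB.mixin Record Lmodule_isPreHilbert (R : realFieldType) H
    of GRing.Lmodule R[i] H := {
  ip : H -> H -> R[i];
  ip_linear : forall x, scalar (ip x);
  ip_herm : forall x y, ip x y = (ip y x)^*;
  ip_ge0 : forall x, nonneg (ip x x);
  ip_eq0 : forall x, ip x x = 0 -> x = 0
}.

#[short(type="preHilbertType")]
HB.structure Definition PreHilbert (R : realFieldType) :=
  {H of Lmodule_isPreHilbert R H & GRing.Lmodule R[i] H}.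

Section ScalarStarAlgebra.
Variable R : realFieldType.

Let cmulZl (c a b : R[i]) : (c *: a) * b = c *: (a * b).
Proof. exact: esym (mulrA c a b). Qed.

Let cmulZr (c a b : R[i]) : a * (c *: b) = c *: (a * b).
Proof. exact: mulrCA. Qed.

Let conjcZ (c a : R[i]) : (c *: a)^* = c^* *: a^*.
Proof. exact: conjcM. Qed.

Let conjcMr (a b : R[i]) : (a * b)^* = b^* * a^*.
Proof. by rewrite conjcM mulrC. Qed.

HB.instance Definition _ := Lmodule_isStarAlgebra.Build R R[i]
  (@mulrA R[i]) (@mulrDl R[i]) (@mulrDr R[i]) cmulZl cmulZr
  (@conjcD R) conjcZ (@conjcK R) conjcMr.

End ScalarStarAlgebra.

Section Positivity.
Variables (R : realFieldType) (A : starAlgType R).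

Definition positive_functional (omega : A -> R[i]) : Prop :=
  scalar omega /\ forall a, nonneg (omega (star a ** a)).

Definition positive (a : A) : Prop :=
  star a = a /\ forall omega, positive_functional omega -> nonneg (omega a).

End Positivity.

Section Span.
Variables (K : pzRingType) (V : lmodType K) (G : set V).

Definition lspan : {pred V} := fun v =>
  `[< exists s : seq (K * V),
        (forall p, p \in s -> G p.2) /\ v = \sum_(p <- s) p.1 *: p.2 >].

Lemma lspanP v : reflect (exists s : seq (K * V),
    (forall p, p \in s -> G p.2) /\ v = \sum_(p <- s) p.1 *: p.2) (v \in lspan).
Proof. exact: asboolP. Qed.

Lemma lspan_submod : submod_closed lspan.
Proof.
split=> [|c u v /lspanP[s [sG ->]] /lspanP[t [tG ->]]].
  by apply/lspanP; exists [::]; rewrite big_nil.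
apply/lspanP; exists ([seq (c * p.1, p.2) | p <- s] ++ t); split.
  by move=> p; rewrite mem_cat => /orP[/mapP[q /sG qG ->]|/tG].
rewrite big_cat big_map scaler_sumr; congr (_ + _).
by apply: eq_bigr => p _; rewrite scalerA.
Qed.

HB.instance Definition _ := GRing.isSubmodClosed.Build K V lspan lspan_submod.

Let lspan_oppr : oppr_closed lspan.
Proof. by move=> v vG; rewrite -scaleN1r rpredZ. Qed.

HB.instance Definition _ := GRing.isOppClosed.Build V lspan lspan_oppr.

Lemma lspan_gen v : G v -> v \in lspan.
Proof.
move=> Gv; apply/lspanP; exists [:: (1, v)]; rewrite big_seq1 scale1r.
by split=> // p; rewrite inE => /eqP ->.
Qed.

Lemma lspan_ind (P : V -> Prop) : P 0 ->
  (forall c u v, G u -> P v -> P (c *: u + v)) ->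
  forall v, v \in lspan -> P v.
Proof.
move=> P0 PD v /lspanP[s [sG ->]]; elim: s sG => [|p s IHs] sG.
  by rewrite big_nil.
rewrite big_cons; apply: PD; first exact/sG/mem_head.
by apply: IHs => q qs; apply: sG; rewrite inE qs orbT.
Qed.

End Span.

Section FiniteRank.
Variables (R : realFieldType) (H : preHilbertType R).
Implicit Types x y z : H.

Definition theta x y : H -> H := fun z => ip y z *: x.

Definition thetas : set (H -> H) := [set T | exists x y, T = theta x y].

Record finrank := Finrank {
  finrank_fun :> H -> H;
  finrankP : finrank_fun \in lspan thetas }.

HB.instance Definition _ := [isSub for finrank_fun].
HB.instance Definition _ := [Choice of finrank by <:].
HB.instance Definition _ :=
  [SubChoice_isSubLmodule of finrank by <:].

Implicit Types S T : finrank.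

Lemma theta_subproof x y : theta x y \in lspan thetas.
Proof. by apply: lspan_gen; exists x, y. Qed.

Definition Theta x y : finrank := Finrank (theta_subproof x y).

Definition adjoint (T S : H -> H) : Prop :=
  forall x y, ip (S x) y = ip x (T y).

Lemma ipDr x y z : ip x (y + z) = ip x y + ip x z.
Proof. by have := ip_linear x 1 y z; rewrite scale1r mul1r. Qed.

Lemma ipDl x y z : ip (y + z) x = ip y x + ip z x.
Proof. by rewrite ip_herm ipDr conjcD -!ip_herm. Qed.

Lemma ip0r x : ip x 0 = 0.
Proof. by apply: (addrI (ip x 0)); rewrite -ipDr !addr0. Qed.

Lemma ipZr c x y : ip x (c *: y) = c * ip x y.
Proof. by have := ip_linear x c y 0; rewrite !addr0 ip0r addr0. Qed.

Lemma ipZl c x y : ip (c *: x) y = c^* * ip x y.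
Proof. by rewrite ip_herm ipZr conjcM -ip_herm. Qed.

Lemma ip0l x : ip 0 x = 0.
Proof. by rewrite ip_herm ip0r conjc0. Qed.

Lemma ip_inj x y : (forall z, ip x z = ip y z) -> x = y.
Proof.
move=> xy; apply/eqP; rewrite -subr_eq0; apply/eqP/ip_eq0.
by rewrite ipDl -scaleN1r ipZl xy -ipZl -ipDl scaleN1r subrr ip0l.
Qed.

Lemma adjoint_sym (T S : H -> H) : adjoint T S -> adjoint S T.
Proof. by move=> TS x y; rewrite ip_herm -TS -ip_herm. Qed.

Lemma adjoint_uniq (T S S' : H -> H) : adjoint T S -> adjoint T S' -> S = S'.
Proof.
by move=> TS TS'; apply/funext => x; apply: ip_inj => y; rewrite TS TS'.
Qed.

Lemma theta_adjoint x y : adjoint (theta x y) (theta y x).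
Proof. by move=> u v; rewrite /theta ipZl ipZr mulrC -ip_herm. Qed.

Lemma finrank_adjoint T : exists S : finrank, adjoint T S.
Proof.
suff [S sS TS] : exists2 S, S \in lspan thetas & adjoint T S.
  by exists (Finrank sS).
apply: (lspan_ind (P := fun T : H -> H =>
  exists2 S, S \in lspan thetas & adjoint T S) _ _ (finrankP T)) => [|c _ V [x [y ->]] [S sS VS]].
  by exists 0; [exact: rpred0 | move=> x y; rewrite ip0l ip0r].
exists (c^* *: theta y x + S).
  by rewrite rpredD ?rpredZ ?theta_subproof.
by move=> u v; rewrite /= ipDl ipDr ipZl ipZr conjcK theta_adjoint VS.
Qed.

(* The involution is determined by [frstar (Theta x y) = Theta y x] and
   antilinearity; to have it well defined it is introduced as the adjoint. *)
Definition frstar T : finrank := projT1 (cid (finrank_adjoint T)).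

Lemma frstarP T : adjoint T (frstar T).
Proof. exact: projT2 (cid (finrank_adjoint T)). Qed.

Lemma frstar_uniq T S : adjoint T S -> frstar T = S.
Proof. by move=> TS; apply/val_inj/(adjoint_uniq (frstarP T)). Qed.

Lemma frstar_Theta x y : frstar (Theta x y) = Theta y x.
Proof. exact/frstar_uniq/theta_adjoint. Qed.

Lemma finrank_linear T : linear T.
Proof.
move=> c x y; have TT := adjoint_sym (frstarP T).
by apply: ip_inj => z; rewrite TT !(ipDl, ipZl) !TT.
Qed.

Lemma finrank_comp T S : (T \o S) \in lspan thetas.
Proof.
apply: (lspan_ind (P := fun T : H -> H => T \o S \in lspan thetas)
  _ _ (finrankP T)) => [|c _ V [x [y ->]] VS].
  exact: rpred0.
have -> : (c *: theta x y + V) \o S = c *: theta x (frstar S y) + (V \o S).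
  apply/funext => z; congr (c *: _ + _).
  by rewrite /theta (frstarP S).
by rewrite rpredD ?rpredZ ?theta_subproof.
Qed.

Definition frmul T S : finrank := Finrank (finrank_comp T S).

Let frext T S : T =1 S -> T = S.
Proof. by move=> TS; apply/val_inj/funext. Qed.

Let frmulA : associative frmul.
Proof. by move=> T S U; apply: frext. Qed.

Let frmulDl : left_distributive frmul +%R.
Proof. by move=> T S U; apply: frext. Qed.

Let frmulDr : right_distributive frmul +%R.
Proof.
move=> T S U; apply: frext => x /=.
by have := finrank_linear T 1 (S x) (U x); rewrite !scale1r.
Qed.

Let frmulZl (c : R[i]) T S : frmul (c *: T) S = c *: frmul T S.
Proof. exact: frext. Qed.

Let frmulZr (c : R[i]) T S : frmul T (c *: S) = c *: frmul T S.
Proof.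
apply: frext => x /=; have T0 : T 0 = 0.
  by have := finrank_linear T (-1) 0 0; rewrite scaleN1r addNr scaleN1r addNr.
by have := finrank_linear T c (S x) 0; rewrite T0 !addr0.
Qed.

Let frstarD : {morph frstar : T S / T + S >-> T + S}.
Proof.
by move=> T S; apply: frstar_uniq => x y; rewrite /= ipDl ipDr !frstarP.
Qed.

Let frstarZ (c : R[i]) T : frstar (c *: T) = c^* *: frstar T.
Proof. by apply: frstar_uniq => x y; rewrite /= ipZl ipZr conjcK frstarP. Qed.

Let frstarK : involutive frstar.
Proof. by move=> T; apply/frstar_uniq/adjoint_sym/frstarP. Qed.

Let frstarM T S : frstar (frmul T S) = frmul (frstar S) (frstar T).
Proof. by apply: frstar_uniq => x y; rewrite /= !frstarP. Qed.

HB.instance Definition _ := Lmodule_isStarAlgebra.Build R finrank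
  frmulA frmulDl frmulDr frmulZl frmulZr frstarD frstarZ frstarK frstarM.

End FiniteRank.

(* [rep_star] says that each [rep a] is adjointable with adjoint
   [rep (star a)]. *)
Record starRep (R : realFieldType) (A : starAlgType R) (K : preHilbertType R) :=
  StarRep {
  rep :> A -> {linear K -> K};
  repD : forall a b x, rep (a + b) x = rep a x + rep b x;
  repZ : forall (c : R[i]) a x, rep (c *: a) x = c *: rep a x;
  repM : forall a b x, rep (a ** b) x = rep a (rep b x);
  rep_star : forall a x y, ip (rep (star a) x) y = ip x (rep a y)
}.

(* Algebras need not be unital, so no unitality is imposed on the actions. *)
Record bimodule (R : realFieldType) (B A : starAlgType R) := Bimodule {
  bimodule_sort :> lmodType R[i];
  lact : B -> bimodule_sort -> bimodule_sort;
  ract : bimodule_sort -> A -> bimodule_sort;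
  lact_linearl : forall x, linear (lact^~ x);
  lact_linearr : forall b, linear (lact b);
  lactM : forall b b' x, lact (b ** b') x = lact b (lact b' x);
  ract_linearl : forall a, linear (ract^~ a);
  ract_linearr : forall x, linear (ract x);
  ractM : forall x a a', ract x (a ** a') = ract (ract x a) a';
  lractA : forall b x a, ract (lact b x) a = lact b (ract x a)
}.

Section ConjugateModule.
Variables (R : realFieldType) (V : lmodType R[i]).

Definition conjm : Type := V.

HB.instance Definition _ := GRing.Zmodule.on conjm.

Definition conjm_scale (c : R[i]) (v : conjm) : conjm := c^* *: (v : V).

Let conjm_scaleA a b v :
  conjm_scale a (conjm_scale b v) = conjm_scale (a * b) v.
Proof. by rewrite /conjm_scale scalerA conjcM. Qed.

Let conjm_scale1 : left_id 1 conjm_scale.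
Proof.
move=> v; rewrite /conjm_scale (_ : 1^* = 1) ?scale1r //.
by congr Complex; exact: oppr0.
Qed.

Let conjm_scaleDr : right_distributive conjm_scale +%R.
Proof. by move=> c u v; exact: scalerDr. Qed.

Let conjm_scaleDl v : {morph conjm_scale^~ v : a b / a + b}.
Proof. by move=> a b; rewrite /conjm_scale conjcD scalerDl. Qed.

HB.instance Definition _ := GRing.Zmodule_isLmodule.Build R[i] conjm
  conjm_scaleA conjm_scale1 conjm_scaleDr conjm_scaleDl.

End ConjugateModule.

Section ConjugateBimodule.
Variables (R : realFieldType) (B A : starAlgType R) (X : bimodule B A).

Definition conj_lact (a : A) (x : conjm X) : conjm X := ract (x : X) (star a).
Definition conj_ract (x : conjm X) (b : B) : conjm X := lact (star b) (x : X).

Let clact_linearl x : linear (conj_lact^~ x).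
Proof.
by move=> c a b; rewrite /conj_lact starD starZ ract_linearr.
Qed.

Let clact_linearr a : linear (conj_lact a).
Proof. by move=> c x y; exact: ract_linearl. Qed.

Let clactM a b x : conj_lact (a ** b) x = conj_lact a (conj_lact b x).
Proof. by rewrite /conj_lact starM ractM. Qed.

Let cract_linearl b : linear (conj_ract^~ b).
Proof. by move=> c x y; exact: lact_linearr. Qed.

Let cract_linearr x : linear (conj_ract x).
Proof.
by move=> c a b; rewrite /conj_ract starD starZ lact_linearl.
Qed.

Let cractM x a b : conj_ract x (a ** b) = conj_ract (conj_ract x a) b.
Proof. by rewrite /conj_ract starM lactM. Qed.

Let clractA a x b : conj_ract (conj_lact a x) b = conj_lact a (conj_ract x b).
Proof. by rewrite /conj_lact /conj_ract lractA. Qed.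

Definition conj_bimodule : bimodule A B := @Bimodule R A B (conjm X)
  conj_lact conj_ract clact_linearl clact_linearr clactM
  cract_linearl cract_linearr cractM clractA.

End ConjugateBimodule.

Section QuotientModule.
Variables (K : pzRingType) (V : lmodType K) (G : set V).

Local Notation N := (lspan G : zmodClosed V).

Definition quotmod : Type := Quotient.quot N.

HB.instance Definition _ := GRing.Zmodule.on quotmod.

Definition quotmod_pi (v : V) : quotmod := \pi_(Quotient.quot N) v.

Definition quotmod_scale (c : K) (q : quotmod) : quotmod :=
  quotmod_pi (c *: repr (q : Quotient.quot N)).

Lemma quotmod_piP u v : quotmod_pi u = quotmod_pi v <-> u - v \in lspan G.
Proof. by rewrite Quotient.idealrBE; split=> [/eqP|/eqP]. Qed.

Lemma quotmod_piK (q : quotmod) : quotmod_pi (repr (q : Quotient.quot N)) = q.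
Proof. exact: reprK. Qed.

Lemma quotmod_piD u v : quotmod_pi (u + v) = quotmod_pi u + quotmod_pi v.
Proof. exact: raddfD (\pi_(Quotient.quot N)) u v. Qed.

Lemma quotmod_piZ c v : quotmod_pi (c *: v) = quotmod_scale c (quotmod_pi v).
Proof.
apply/quotmod_piP; rewrite -scalerBr rpredZ //; apply/quotmod_piP.
by rewrite quotmod_piK.
Qed.

Let qscaleA a b q :
  quotmod_scale a (quotmod_scale b q) = quotmod_scale (a * b) q.
Proof. by rewrite -[q]quotmod_piK -!quotmod_piZ scalerA. Qed.

Let qscale1 : left_id 1 quotmod_scale.
Proof. by move=> q; rewrite -[q]quotmod_piK -quotmod_piZ scale1r. Qed.

Let qscaleDr : right_distributive quotmod_scale +%R.
Proof.
move=> c q r; rewrite -[q]quotmod_piK -[r]quotmod_piK -quotmod_piD.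
by rewrite -!quotmod_piZ scalerDr quotmod_piD.
Qed.

Let qscaleDl q : {morph quotmod_scale^~ q : a b / a + b}.
Proof.
by move=> a b; rewrite -[q]quotmod_piK -!quotmod_piZ scalerDl quotmod_piD.
Qed.

HB.instance Definition _ := GRing.Zmodule_isLmodule.Build K quotmod
  qscaleA qscale1 qscaleDr qscaleDl.

Lemma quotmod_pi_linear : linear quotmod_pi.
Proof. by move=> c u v; rewrite quotmod_piD quotmod_piZ. Qed.

End QuotientModule.

Section BalancedTensor.
Variables (R : realFieldType) (B A : starAlgType R) (X : bimodule B A).
Variables (K : preHilbertType R) (pi : starRep A K).

Definition free_tensor : lmodType R[i] := @malg (X * K)%type R[i].

Definition free_pure (x : X) (psi : K) : free_tensor :=
  mkmalgU (x, psi) (1 : R[i]).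

Definition tensor_relations : set free_tensor := [set u |
  [\/ exists c x y psi,
        u = free_pure (c *: x + y) psi
            - (c *: free_pure x psi + free_pure y psi),
      exists c x psi phi,
        u = free_pure x (c *: psi + phi)
            - (c *: free_pure x psi + free_pure x phi)
    | exists x a psi,
        u = free_pure (ract x a) psi - free_pure x (pi a psi)]].

Definition tensor : lmodType R[i] := quotmod tensor_relations.

Definition pure (x : X) (psi : K) : tensor :=
  @quotmod_pi _ _ tensor_relations (free_pure x psi).

Lemma pure_linearl psi : linear (pure^~ psi).
Proof.
move=> c x y; apply: etrans _ (quotmod_pi_linear _ _ _ _).
by apply/quotmod_piP/lspan_gen; constructor 1; exists c, x, y, psi.
Qed.

Lemma pure_linearr x : linear (pure x).
Proof.
move=> c psi phi; apply: etrans _ (quotmod_pi_linear _ _ _ _).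
by apply/quotmod_piP/lspan_gen; constructor 2; exists c, x, psi, phi.
Qed.

Lemma pure_balanced x a psi : pure (ract x a) psi = pure x (pi a psi).
Proof. by apply/quotmod_piP/lspan_gen; constructor 3; exists x, a, psi. Qed.

End BalancedTensor.

Definition sesquilinear (R : realFieldType) (V : lmodType R[i])
    (h : V -> V -> R[i]) : Prop :=
  (forall u, scalar (h u)) /\
  (forall c u v w, h (c *: u + v) w = c^* * h u w + h v w).

Definition property_P (R : realFieldType) (B A : starAlgType R)
    (X : bimodule B A) (ipA : X -> X -> A) : Prop :=
  forall (K : preHilbertType R) (pi : starRep A K),
  exists h : tensor X pi -> tensor X pi -> R[i],
    [/\ sesquilinear h,
        forall x y psi phi,
          h (pure pi x psi) (pure pi y phi) = ip psi (pi (ipA x y) phi)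
      & forall u, nonneg (h u u)].

Record equivBimodule (R : realFieldType) (B A : starAlgType R) :=
  EquivBimodule {
  eb_bimodule :> bimodule B A;
  ipr : eb_bimodule -> eb_bimodule -> A;
  ipl : eb_bimodule -> eb_bimodule -> B;
  ipr_linear : forall x, linear (ipr x);
  ipr_herm : forall x y, ipr x y = star (ipr y x);
  ipr_act : forall x y a, ipr x (ract y a) = ipr x y ** a;
  ipr_positive : forall x, positive (ipr x x);
  ipr_adj : forall x b y, ipr x (lact b y) = ipr (lact (star b) x) y;
  ipr_full : forall a, a \in lspan [set a' | exists x y, a' = ipr x y];
  ipl_linear : forall y, linear (ipl^~ y);
  ipl_herm : forall x y, ipl x y = star (ipl y x);
  ipl_act : forall b x y, ipl (lact b x) y = b ** ipl x y;
  ipl_positive : forall x, positive (ipl x x);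
  ipl_adj : forall x a y, ipl (ract x a) y = ipl x (ract y (star a));
  ipl_full : forall b, b \in lspan [set b' | exists x y, b' = ipl x y];
  ip_compat : forall x y z, lact (ipl x y) z = ract x (ipr y z);
  eb_P : property_P (X := eb_bimodule) ipr;
  eb_Q : property_P (X := conj_bimodule eb_bimodule) ipl
}.

Definition formally_Morita_equivalent (R : realFieldType)
    (A B : starAlgType R) : Prop :=
  inhabited (equivBimodule B A).

(* Main.v *)
(* The equivalence bimodule is H itself, with the inner product of H on the
   scalar side and Theta on the finite rank side; fullness on the scalar side
   needs a nonzero vector e.
   Property P: subtracting from the other first legs their projections onto
   the first one, a sum of pure tensors can be rewritten with pairwise
   orthogonal first legs, so that its square is a sum of nonnegative terms; no
   square root is needed because nothing is normalized.
   Property Q: <e, e> Theta x y = (Theta e x)^* (Theta e y), so the form on the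
   conjugate bimodule is the pullback of the inner product of K along
   x (x) psi |-> pi (Theta e x) psi, divided by <e, e>. *)

From HB Require Import structures.
Require Import Defs.
From mathcomp Require Import all_boot all_order all_algebra.
From mathcomp.real_closed Require Import complex.
From mathcomp Require Import boolp classical_sets.
From mathcomp.finmap Require Import finmap.
From mathcomp.multinomials Require Import monalg.

Set Implicit Arguments.
Unset Strict Implicit.
Unset Printing Implicit Defensive.

Import GRing.Theory Num.Theory.
Local Open Scope fset_scope.
Local Open Scope ring_scope.
Local Notation "z ^*" := (conjc z) : ring_scope.

(** * Universal properties of the free module and of the balanced tensor product *)

Lemma malg_lift (I : choiceType) (K : nzRingType) (W : lmodType K)
    (f : I -> W) :
  exists g : {linear {malg K[I]} -> W}, forall i, g << i >> = f i.
Proof.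
pose g (u : {malg K[I]}) := \sum_(i <- msupp u) u@_i *: f i.
(* Coefficients outside the support are 0, so the sum may run over any larger finite set; linearity
   then compares both arguments over the union of their supports. *)
have gE (u : {malg K[I]}) (d : {fset I}) : msupp u `<=` d ->
    g u = \sum_(i <- d) u@_i *: f i.
  move=> ud; apply: (big_fset_incl _ ud) => i _ /mcoeff_outdom ->.
  by rewrite scale0r.
have gP : linear g.
  move=> c u v; pose d := msupp u `|` msupp v.
  have ud : msupp u `<=` d by exact: fsubsetUl.
  have vd : msupp v `<=` d by exact: fsubsetUr.
  rewrite (gE _ d); last first.
    apply: fsubset_trans (msuppD_le _ _) _; rewrite fsubUset vd andbT.
    exact: fsubset_trans (msuppZ_le _ _) ud.
  rewrite (gE u d) // (gE v d) // scaler_sumr -big_split /=.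
  by apply: eq_bigr => i _; rewrite mcoeffD mcoeffZ scalerDl scalerA.
pose gL := GRing.isLinear.Build K {malg K[I]} W *:%R g gP.
pose G : {linear {malg K[I]} -> W} := HB.pack g gL.
exists G => i; rewrite /= (gE _ [fset i]) ?msuppU_le //.
by rewrite big_seq_fset1 mcoeffUU scale1r.
Qed.

HB.instance Definition _ (K : pzRingType) (V : lmodType K) (G : set V) :=
  GRing.isLinear.Build K V (quotmod G) *:%R (@quotmod_pi K V G)
    (@quotmod_pi_linear K V G).

Section TensorLift.
Variables (R : realFieldType) (B A : starAlgType R) (X : bimodule B A).
Variables (K : preHilbertType R) (pi : starRep A K).

Lemma pureDl (x y : X) psi :
  pure pi (x + y) psi = pure pi x psi + pure pi y psi.
Proof. by have := pure_linearl pi psi 1 x y; rewrite !scale1r. Qed.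

Lemma pure0l psi : pure pi (0 : X) psi = 0.
Proof. by apply: (addIr (pure pi 0 psi)); rewrite -pureDl !add0r. Qed.

Lemma pureZl c (x : X) psi : pure pi (c *: x) psi = c *: pure pi x psi.
Proof. by have := pure_linearl pi psi c x 0; rewrite pure0l !addr0. Qed.

(** Take a representative in the free module and absorb each coefficient into the first leg of its
    pure tensor. *)
Lemma tensor_sum (u : tensor X pi) :
  exists s : seq (X * K), u = \sum_(p <- s) pure pi p.1 p.2.
Proof.
rewrite -[u]quotmod_piK; set v : free_tensor X K := repr _.
exists [seq (v@_p *: p.1, p.2) | p <- msupp v].
rewrite big_map {1}[v]monalgE linear_sum.
apply: eq_bigr => p _ /=; rewrite pureZl -linearZ; congr quotmod_pi.
by apply/malgP => q; rewrite mcoeffZ !mcoeffU -surjective_pairing mulrnAr mulr1.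
Qed.

HB.instance Definition _ (x : X) :=
  GRing.isLinear.Build R[i] K (tensor X pi) *:%R (pure pi x)
    (pure_linearr pi x).

Lemma tensor_ext (W : lmodType R[i]) (f g : {linear tensor X pi -> W}) :
  (forall x psi, f (pure pi x psi) = g (pure pi x psi)) -> f =1 g.
Proof.
move=> fg u; have [s ->] := tensor_sum u.
by rewrite !linear_sum; apply: eq_bigr => p _; exact: fg.
Qed.

(** The linear extension of [f] to the free module kills the three kinds of relations, one for each
    hypothesis on [f], and so factors through the quotient. *)
Lemma tensor_lift (W : lmodType R[i]) (f : X -> K -> W) :
  (forall psi, linear (f^~ psi)) -> (forall x, linear (f x)) ->
  (forall x a psi, f (ract x a) psi = f x (pi a psi)) ->
  exists g : {linear tensor X pi -> W},
    forall x psi, g (pure pi x psi) = f x psi.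
Proof.
move=> fl fr fb.
have [g0 g0E] := malg_lift (fun p : X * K => f p.1 p.2).
have g0_ker v : v \in lspan (tensor_relations pi) -> g0 v = 0.
  elim/lspan_ind => [|c r w rR g0w]; first exact: linear0.
  rewrite linearP g0w addr0; case: rR => [[d [x [y [psi ->]]]]|
    [d [x [psi [phi ->]]]]|[x [a [psi ->]]]].
  - by rewrite linearB linearP /= !g0E /= fl subrr scaler0.
  - by rewrite linearB linearP /= !g0E /= fr subrr scaler0.
  - by rewrite linearB /= !g0E /= fb subrr scaler0.
pose g (u : tensor X pi) := g0 (repr u).
have gE v : g (quotmod_pi (tensor_relations pi) v) = g0 v.
  apply/eqP; rewrite -subr_eq0 -linearB; apply/eqP/g0_ker/quotmod_piP.
  exact: quotmod_piK.
have gP : linear g.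
  move=> c u v; rewrite -[u]quotmod_piK -[v]quotmod_piK -linearP !gE.
  exact: linearP.
pose gL := GRing.isLinear.Build R[i] (tensor X pi) W *:%R g gP.
pose G : {linear tensor X pi -> W} := HB.pack g gL.
by exists G => x psi; rewrite /= gE g0E.
Qed.

End TensorLift.

(** * The form induced by an algebra-valued inner product *)

Section TensorForm.
Variables (R : realFieldType) (B A : starAlgType R) (X : bimodule B A).
Variables (K : preHilbertType R) (pi : starRep A K) (ipA : X -> X -> A).
Hypothesis ipA_linear : forall x, linear (ipA x).
Hypothesis ipA_herm : forall x y, ipA x y = star (ipA y x).
Hypothesis ipA_act : forall x y a, ipA x (ract y a) = ipA x y ** a.

(** Reduces property P to nonnegativity on the diagonal. The universal property is applied in the
    second argument, with a pair [(x, psi)] fixed on the left, and then in the first. *)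
Lemma tensor_form : exists h : tensor X pi -> tensor X pi -> R[i],
  sesquilinear h /\ forall x y psi phi,
    h (pure pi x psi) (pure pi y phi) = ip psi (pi (ipA x y) phi).
Proof.
have ipA_semilinear y c x x' : ipA (c *: x + x') y = c^* *: ipA x y + ipA x' y.
  by rewrite ipA_herm ipA_linear starD starZ -!ipA_herm.
have ipA_star x y a : ipA (ract x a) y = star a ** ipA x y.
  by rewrite ipA_herm ipA_act starM -ipA_herm.
have lift1 (p : X * K) : exists g : {linear tensor X pi -> R[i]},
    forall y phi, g (pure pi y phi) = ip p.2 (pi (ipA p.1 y) phi).
  apply: (tensor_lift (f := fun y phi => ip p.2 (pi (ipA p.1 y) phi))).
  - by move=> phi c y z; rewrite ipA_linear repD repZ ip_linear.
  - by move=> y c phi phi'; rewrite linearP ip_linear.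
  - by move=> y a phi; rewrite ipA_act repM.
have [g gE] := choice lift1.
(* Conjugation turns the antilinear dependence on the first argument into a
   linear one, to which the universal property applies again. *)
have lift2 (v : tensor X pi) : exists k : {linear tensor X pi -> R[i]},
    forall x psi, k (pure pi x psi) = (g (x, psi) v)^*.
  apply: (tensor_lift (f := fun x psi => (g (x, psi) v)^*)).
  - move=> psi c x x'.
    have -> : g (c *: x + x', psi) v = c^* * g (x, psi) v + g (x', psi) v.
      apply: (tensor_ext (f := g (c *: x + x', psi))
        (g := (c^* \*: g (x, psi)) \+ g (x', psi))) => y phi /=.
      by rewrite !gE /= ipA_semilinear repD repZ ip_linear.
    by rewrite conjcD conjcM Defs.conjcK.
  - move=> x c psi psi'.
    have -> : g (x, c *: psi + psi') v = c^* * g (x, psi) v + g (x, psi') v.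
      apply: (tensor_ext (f := g (x, c *: psi + psi'))
        (g := (c^* \*: g (x, psi)) \+ g (x, psi'))) => y phi /=.
      by rewrite !gE /= ipDl ipZl.
    by rewrite conjcD conjcM Defs.conjcK.
  - move=> x a psi; congr (_^*).
    apply: (tensor_ext (f := g (ract x a, psi)) (g := g (x, pi a psi))) => y p.
    by rewrite !gE /= ipA_star repM -rep_star starK.
have [k kE] := choice lift2.
(* [k v u] is linear in [u] and antilinear in [v]; conjugation exchanges the two. *)
exists (fun u v => (k v u)^*); split; last first.
  by move=> x y psi phi; rewrite kE Defs.conjcK gE.
split=> [u c v w|c u v w]; last by rewrite linearP conjcD conjcM.
have -> : k (c *: v + w) u = c^* * k v u + k w u.
  apply: (tensor_ext (f := k (c *: v + w))
    (g := (c^* \*: k v) \+ k w)) => x psi /=.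
  by rewrite !kE linearP conjcD conjcM.
by rewrite conjcD conjcM Defs.conjcK.
Qed.

End TensorForm.

(* [conjc1] is only available over a real closed field. *)
Lemma conjC1 (R : realFieldType) : (1 : R[i])^* = 1.
Proof. by congr Complex; exact: oppr0. Qed.

(** * Sesquilinear forms, nonnegative scalars and positive elements *)

Section Sesquilinear.
Variables (R : realFieldType) (V : lmodType R[i]) (h : V -> V -> R[i]).
Hypothesis hS : sesquilinear h.

Lemma sesquiDr u v w : h u (v + w) = h u v + h u w.
Proof. by have := hS.1 u 1 v w; rewrite scale1r mul1r. Qed.

Lemma sesqui0r u : h u 0 = 0.
Proof. by apply: (addIr (h u 0)); rewrite -sesquiDr !add0r. Qed.

Lemma sesquiDl u v w : h (u + v) w = h u w + h v w.
Proof. by have := hS.2 1 u v w; rewrite conjC1 scale1r mul1r. Qed.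

Lemma sesqui0l u : h 0 u = 0.
Proof. by apply: (addIr (h 0 u)); rewrite -sesquiDl !add0r. Qed.

End Sesquilinear.

Lemma rep0 (R : realFieldType) (A : starAlgType R) (K : preHilbertType R)
  (pi : starRep A K) x : pi 0 x = 0.
Proof. by apply: (addIr (pi 0 x)); rewrite -repD !add0r. Qed.

Section Nonneg.
Variable R : realFieldType.
Implicit Types z w : R[i].

Lemma nonnegP z : reflect (exists2 r, 0 <= r & z = (r%:C)%C) (nonneg z).
Proof.
apply: (iffP andP) => [[/eqP z0 r0]|[r r0 ->]]; last by [].
by exists (complex.Re z) => //; case: z z0 r0 => a b /= ->.
Qed.

Lemma nonneg0 : nonneg (0 : R[i]).
Proof. by apply/nonnegP; exists 0. Qed.

Lemma nonnegD z w : nonneg z -> nonneg w -> nonneg (z + w).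
Proof.
move=> /nonnegP[r r0 ->] /nonnegP[s s0 ->]; apply/nonnegP.
by exists (r + s); rewrite ?addr_ge0 // rmorphD.
Qed.

Lemma nonnegM z w : nonneg z -> nonneg w -> nonneg (z * w).
Proof.
move=> /nonnegP[r r0 ->] /nonnegP[s s0 ->]; apply/nonnegP.
by exists (r * s); rewrite ?mulr_ge0 // rmorphM.
Qed.

Lemma nonnegV z : nonneg z -> nonneg z^-1.
Proof.
move=> /nonnegP[r r0 ->]; apply/nonnegP.
by exists r^-1; rewrite ?invr_ge0 // fmorphV.
Qed.

Lemma nonneg_conj z : nonneg z -> z^* = z.
Proof. by case/nonnegP=> r _ ->; congr Complex; exact: oppr0. Qed.

End Nonneg.

(** The scalar stays outside the square, since an ordered field may lack square roots; both [ip x x]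
    and [Theta x x] will be brought to this form. *)
Lemma positive_sqr (R : realFieldType) (A : starAlgType R) (c : R[i]) (a : A) :
  nonneg c -> positive (c *: (star a ** a)).
Proof.
move=> c0; split=> [|w [wL wP]].
  by rewrite starZ starM starK nonneg_conj.
have w0 : w 0 = 0 by have := wL (-1) 0 0; rewrite scaleN1r addNr mulN1r addNr.
by have := wL c (star a ** a) 0; rewrite w0 !addr0 => ->; exact: nonnegM.
Qed.

Lemma positive_scalar (R : realFieldType) (c : R[i]) :
  nonneg c -> positive (c : (R[i] : starAlgType R)).
Proof.
move=> c0; have -> : c = c *: (star (1 : R[i]) ** 1).
  by rewrite [star _]conjC1 -[RHS]/(c * (1 * 1)) !mulr1.
exact: positive_sqr.
Qed.

(** The vector functional of [psi] is positive, as it sends [star b ** b] to the inner square of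
    [pi b psi]. *)
Lemma rep_positive (R : realFieldType) (A : starAlgType R)
    (K : preHilbertType R) (pi : starRep A K) a psi :
  positive a -> nonneg (ip psi (pi a psi)).
Proof.
case=> _ a_ge0; apply: (a_ge0 (fun b => ip psi (pi b psi))).
split=> [c b b'|b]; first by rewrite repD repZ ip_linear.
by rewrite repM -rep_star starK; exact: ip_ge0.
Qed.

(** * The space H as a bimodule over finite rank operators and scalars *)

Section Equivalence.
Variables (R : realFieldType) (H : preHilbertType R).
Implicit Types (x y z : H) (c : R[i]) (T : finrank H).

Lemma ip_neq0 x : x <> 0 -> ip x x != 0.
Proof. by move=> x0; apply/eqP => /ip_eq0. Qed.

Lemma finrank_ext (T S : finrank H) : T =1 S -> T = S.
Proof. by move=> TS; apply/val_inj/funext. Qed.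

Lemma finrankDE T S x : (T + S) x = T x + S x.
Proof. by []. Qed.

Lemma finrankZE c T x : (c *: T) x = c *: T x.
Proof. by []. Qed.

Lemma ThetaE x y z : Theta x y z = ip y z *: x.
Proof. by []. Qed.

Lemma Theta_linearl y : linear (fun x => Theta x y).
Proof.
move=> c x x'; apply: finrank_ext => z.
by rewrite finrankDE finrankZE !ThetaE scalerDr !scalerA mulrC.
Qed.

Lemma Theta_linearr x c y y' :
  Theta x (c *: y + y') = c^* *: Theta x y + Theta x y'.
Proof.
apply: finrank_ext => z.
by rewrite finrankDE finrankZE !ThetaE ipDl ipZl scalerDl scalerA.
Qed.

Lemma finrank0 T : T 0 = 0.
Proof. by have := finrank_linear T (-1) 0 0; rewrite !scaleN1r !addNr. Qed.

Lemma finrankZ c T x : T (c *: x) = c *: T x.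
Proof. by have := finrank_linear T c x 0; rewrite finrank0 !addr0. Qed.

Lemma Theta_mull T x y : T ** Theta x y = Theta (T x) y.
Proof. by apply: finrank_ext => z; exact: finrankZ. Qed.

Lemma Theta_mulr T x y : Theta x y ** T = Theta x (star T y).
Proof.
apply: finrank_ext => z.
by rewrite -[LHS]/(ip y (T z) *: x) ThetaE -[star T]/(frstar T) frstarP.
Qed.

Lemma ThetaM x y z : Theta x y ** Theta y z = ip y y *: Theta x z.
Proof.
apply: finrank_ext => u.
by rewrite Theta_mull finrankZE !ThetaE !scalerA mulrC.
Qed.

Lemma Theta_full T :
  T \in lspan [set S : finrank H | exists x y, S = Theta x y].
Proof.
(* The span defining [finrank] lives among all maps on H; the induction lifts each partial sum to
   the subtype. *)
suff [S S_span /val_inj <-] : exists2 S : finrank H,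
    S \in lspan [set S | exists x y, S = Theta x y] & S = T :> (H -> H) by [].
elim/lspan_ind: {T}(T : H -> H) / (finrankP T)
  => [|c _ _ [x [y ->]] [S S_span <-]].
  by exists 0; first exact: rpred0.
exists (c *: Theta x y + S) => //.
by apply: rpredD => //; apply/rpredZ/lspan_gen; exists x, y.
Qed.

Definition finrank_bimodule : bimodule (finrank H) R[i].
Proof.
refine (@Bimodule R (finrank H) R[i] H (fun T x => T x) (fun x c => c *: x)
  _ _ _ _ _ _ _).
- by [].
- by move=> T; exact: finrank_linear.
- by [].
- by move=> a c x y; rewrite scalerDr !scalerA mulrC.
- by move=> x c a b; rewrite scalerDl scalerA.
- by move=> x a b; rewrite scalerA mulrC.
- by move=> T x c; rewrite finrankZ.
Defined.

Lemma ip_property_P : property_P (X := finrank_bimodule) (@ip R H).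
Proof.
move=> K pi.
have [|||h [hS hE]] :=
  @tensor_form R (finrank H) R[i] finrank_bimodule K pi (@ip R H).
- exact: ip_linear.
- exact: ip_herm.
- by move=> x y c; rewrite ipZr mulrC.
exists h; split=> // u.
have [s ->] := tensor_sum u.
(* Induction on the length, since orthogonalization changes every entry of the tail. *)
have [n] := ubnP (size s); elim: n s => // n IHn [|[x psi] s] /= s_n.
  by rewrite big_nil (sesqui0r hS) nonneg0.
rewrite big_cons /=; have [->|/eqP x_neq0] := eqVneq x 0.
  by rewrite pure0l add0r IHn.
(* [c y *: x] is the projection of [y] onto [x], and [r] keeps the remainder; by bilinearity the
   projected parts move into the second leg [phi]. *)
pose c y := ip x y / ip x x.
pose r (p : finrank_bimodule * K) : finrank_bimodule * K :=
  (p.1 - c p.1 *: x, p.2).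
pose w : tensor finrank_bimodule pi :=
  \sum_(p <- map r s) pure pi p.1 p.2.
pose phi := psi + \sum_(p <- s) c p.1 *: p.2.
have -> : pure pi x psi + \sum_(p <- s) pure pi p.1 p.2 = pure pi x phi + w.
  rewrite linearD -addrA; congr (_ + _).
  rewrite /w big_map linear_sum -big_split; apply: eq_bigr => p _ /=.
  rewrite linearZ /= -(pureZl pi (c p.1) (x : finrank_bimodule)) -pureDl.
  by rewrite addrC subrK.
have x_orth p : ip x (r p).1 = 0.
  rewrite /r /= -scaleNr ipDr ipZr mulNr /c divfK ?subrr //.
  exact: ip_neq0.
have h_orth (y z : finrank_bimodule) chi chi' :
    ip y z = 0 -> h (pure pi y chi) (pure pi z chi') = 0.
  by move=> yz; rewrite hE yz rep0 ip0r.
have xw : h (pure pi x phi) w = 0.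
  rewrite /w big_map; elim/big_ind: _ => [|u1 u2 u1_0 u2_0|p _].
  - exact: sesqui0r hS _.
  - by rewrite (sesquiDr hS) u1_0 u2_0 addr0.
  - exact/h_orth/x_orth.
have wx : h w (pure pi x phi) = 0.
  rewrite /w big_map; elim/big_ind: _ => [|u1 u2 u1_0 u2_0|p _].
  - exact: sesqui0l hS _.
  - by rewrite (sesquiDl hS) u1_0 u2_0 addr0.
  - by apply: h_orth; rewrite ip_herm x_orth Defs.conjc0.
(* The cross terms vanish, and [w] has as many terms as [s], so the induction hypothesis covers its
   square. *)
rewrite (sesquiDl hS) !(sesquiDr hS) xw wx addr0 add0r.
apply: nonnegD; last by apply: IHn; rewrite size_map.
(* [pi] need not be unital, so [ip x x] is not pulled out of [pi] but used as a positive element of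
   the scalar algebra. *)
by rewrite hE; apply: rep_positive; exact: positive_scalar (ip_ge0 x).
Qed.

Lemma Theta_property_Q (e : H) : e <> 0 ->
  property_P (X := conj_bimodule finrank_bimodule) (@Theta R H).
Proof.
move=> e_neq0 K pi; have ee := ip_neq0 e_neq0.
have [|||g gE] := @tensor_lift R R[i] (finrank H)
  (conj_bimodule finrank_bimodule) K pi K (fun x psi => pi (Theta e x) psi).
- move=> psi c x y.
  (* [c *: x] is scaling in the conjugate module, which cancels the antilinearity of [Theta e]. *)
  have -> : Theta e (c *: x + y) = c *: Theta e x + Theta e y.
    by rewrite [LHS]Theta_linearr Defs.conjcK.
  by rewrite repD repZ.
- by move=> x c psi phi; rewrite linearP.
(* In the conjugate bimodule [T] acts on the right by [star T]. *)
- by move=> x T psi; rewrite -repM Theta_mulr.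
have eeV_ge0 : nonneg (ip e e)^-1 by apply/nonnegV/ip_ge0.
exists (fun u v => (ip e e)^-1 * ip (g u) (g v)); split.
- split=> [u c v w|c u v w].
    by rewrite linearP ip_linear mulrDr mulrCA.
  by rewrite linearP ipDl ipZl mulrDr mulrCA.
- move=> x y psi phi; rewrite !gE -(starK (Theta e x)) rep_star -repM.
  by rewrite [star _]frstar_Theta ThetaM repZ ipZr mulrA mulVf ?mul1r.
- by move=> u; apply: nonnegM => //; exact: ip_ge0.
Qed.

(** [Theta x x] is self-adjoint and its square is [ip x x *: Theta x x]; dividing by [ip x x]
    requires [x] nonzero. *)
Lemma Theta_positive x : positive (Theta x x : (finrank H : starAlgType R)).
Proof.
have [->|/eqP x_neq0] := eqVneq x 0.
  have -> : Theta 0 0 = 0 *: (star (0 : finrank H) ** 0).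
    by rewrite scale0r; apply: finrank_ext => z; rewrite ThetaE scaler0.
  exact/positive_sqr/nonneg0.
have -> : Theta x x = (ip x x)^-1 *: (star (Theta x x) ** Theta x x).
  by rewrite [star _]frstar_Theta ThetaM scalerA mulVf ?scale1r ?ip_neq0.
exact/positive_sqr/nonnegV/ip_ge0.
Qed.

Lemma ip_full x : x <> 0 ->
  forall c, c \in lspan [set c' : R[i] | exists x y, c' = ip x y].
Proof.
move=> x_neq0 c; apply: lspan_gen; exists x, ((c / ip x x) *: x).
by rewrite ipZr divfK // ip_neq0.
Qed.

End Equivalence.

Theorem proposition6p8 (R : realFieldType) (H : preHilbertType R)
    (H_neq0 : exists x : H, x <> 0) :
  formally_Morita_equivalent (R[i] : starAlgType R) (finrank H : starAlgType R).
Proof.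
case: H_neq0 => e e_neq0; constructor.
refine (@EquivBimodule R (finrank H) R[i] (finrank_bimodule H)
  (@ip R H) (@Theta R H) _ _ _ _ _ _ _ _ _ _ _ _ _ _ _).
- exact: ip_linear.
- exact: ip_herm.
- by move=> x y c; rewrite ipZr mulrC.
- by move=> x; exact/positive_scalar/ip_ge0.
- by move=> x T y; apply: esym; exact: frstarP.
- exact: ip_full e_neq0.
- exact: Theta_linearl.
- by move=> x y; rewrite [RHS]frstar_Theta.
- by move=> T x y; rewrite Theta_mull.
- by move=> x; exact: Theta_positive.
- move=> x c y; apply: finrank_ext => z.
  by rewrite !ThetaE ipZl Defs.conjcK scalerA mulrC.
- exact: Theta_full.
(* Compatibility: both sides unfold to [ip y z *: x]. *)
- by [].
- exact: ip_property_P.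
- exact: Theta_property_Q e_neq0.
Qed.
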